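(* Let $r\in\mathbb{N}$, $n\in\mathbb{N}_0$, $a,b\in\mathbb{R}$, and $|\lambda|<1$. Then $$\int_a^b\Phi^{B,r}_{M,\lambda}(-n,x)\,d_Mx=\frac{\Phi^{B,r}_{M,\lambda}(-(n+1),b)-\Phi^{B,r}_{M,\lambda}(-(n+1),a)}{M_{n+1}}$$ and $$\int_a^b\Phi^{E,r}_{M,\lambda}(-n,x)\,d_Mx=\frac{\Phi^{E,r}_{M,\lambda}(-(n+1),b)-\Phi^{E,r}_{M,\lambda}(-(n+1),a)}{M_{n+1}}.$$
   Context: $\mathbb{N}=\{1,2,\ldots\}$, $\mathbb{N}_0=\{0,1,2,\ldots\}$. For $n\ge 0$, $M_n=2^n-1$ is the $n$-th Mersenne number. The M-factorial is $M_0!=1$ and $M_n!=M_nM_{n-1}\cdots M_1$ for $n\geq 1$. The M-exponential is $e_M^{xt}=\sum_{n=0}^{\infty}\frac{x^nt^n}{M_n!}$, and $e_M^t$ denotes the case $x=1$. For $m\in\mathbb{N}_0$ the Mersenne translation polynomials $P_{n,M}(x;m)$ are defined by $e_M^{xt}\left(e_M^t\right)^m=\sum_{n=0}^{\infty}P_{n,M}(x;m)\frac{t^n}{M_n!}$, where $(e_M^t)^m$ is the ordinary $m$-fold product. For $r\in\mathbb{N}$, $n\in\mathbb{N}_0$, $x\in\mathbb{C}$ and $|\lambda|<1$, the Bernoulli-type and Euler-type Mersenne-Lerch interpolation values of order $r$ at the nonpositive integer $-n$ are defined by the (convergent) series $\Phi^{B,r}_{M,\lambda}(-n,x)=\sum_{m=0}^{\infty}\binom{m+r-1}{m}\lambda^mP_{n,M}(x;m)$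 and $\Phi^{E,r}_{M,\lambda}(-n,x)=\sum_{m=0}^{\infty}(-1)^m\binom{m+r-1}{m}\lambda^mP_{n,M}(x;m)$, respectively, where $\binom{m+r-1}{m}$ is the ordinary binomial coefficient. For a function $f$, the M-derivative is $D_xf(x)=\frac{f(2x)-f(x)}{x}$ for $x\neq 0$, with $D_xf(0)=\lim_{x\to 0}D_xf(x)$ whenever the limit exists. The M-integral is taken as the inverse operation of the M-derivative: if $D_xF(x)=f(x)$, then $\int_a^bf(x)\,d_Mx=F(b)-F(a)$. For monomials, this gives $\int_0^1x^n\,d_Mx=\frac{1}{M_{n+1}}$ for $n\ge 0$.
   Formalization: The M-integral is taken over M-antiderivatives F continuous at 0; without this F(b)-F(a) is not determined by f, since any function with G(2x)=G(x) may be added. Existence of such an F, and the same value for every such F, are both asserted. *)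

(* Defs.v *)
From Stdlib Require Import Reals.
From Coquelicot Require Import Coquelicot.

Open Scope R_scope.

Definition mersenne (n : nat) : R := 2 ^ n - 1.

Fixpoint mersenne_fact (n : nat) : R :=
  match n with
  | O => 1
  | S p => mersenne (S p) * mersenne_fact p
  end.

(* A power series in t is represented by its sequence of coefficients, so the
   generating-function identity below is read as an identity of formal power
   series. *)
Definition fps : Type := nat -> C.

Definition fps_one : fps :=
  fun n => match n with O => RtoC 1 | S _ => RtoC 0 end.

(* Cauchy product; sum_n has n+1 terms, k = 0, ..., n. *)
Definition fps_mul (f g : fps) : fps :=
  fun n => sum_n (fun k => (f k * g (n - k)%nat)%C) n.

Fixpoint fps_pow (f : fps) (m : nat) : fps :=
  match m with
  | O => fps_one
  | S p => fps_mul f (fps_pow f p)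
  end.

(* e_M^{xt} as a power series in t. *)
Definition M_exp (x : C) : fps :=
  fun n => (x ^ n / mersenne_fact n)%C.

(* P_{n,M}(x;m): M_n! times the coefficient of t^n in e_M^{xt} (e_M^t)^m. *)
Definition M_translation (n : nat) (x : C) (m : nat) : C :=
  (mersenne_fact n * fps_mul (M_exp x) (fps_pow (M_exp 1) m) n)%C.

(* Sum of a convergent complex series; an unspecified value otherwise. *)
Definition CSeries (u : nat -> C) : C :=
  (Series (fun m => Re (u m)), Series (fun m => Im (u m))).

(* Phi_B r lam n x and Phi_E r lam n x are the values at (-n, x).  The binomial
   coefficient is Stdlib's [Binomial.C] ([C] alone is the complex numbers); the
   truncated subtraction is harmless for 1 <= r. *)
Definition Phi_B (r : nat) (lam : C) (n : nat) (x : C) : C :=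
  CSeries (fun m =>
    (Binomial.C (m + r - 1) m * lam ^ m * M_translation n x m)%C).

Definition Phi_E (r : nat) (lam : C) (n : nat) (x : C) : C :=
  CSeries (fun m =>
    ((-1) ^ m * Binomial.C (m + r - 1) m * lam ^ m * M_translation n x m)%C).

Definition M_quot (F : C -> C) (x : C) : C := ((F (2 * x) - F x) / x)%C.

(* [is_M_derive F x l]: D_x F exists at x and equals l. *)
Definition is_M_derive (F : C -> C) (x l : C) : Prop :=
  (x <> RtoC 0 -> M_quot F x = l) /\
  (x = RtoC 0 -> filterlim (M_quot F) (locally' x) (locally l)).

(* Continuity at 0 is the usual normalisation in q-calculus: without it F may be
   perturbed by any function of x invariant under x |-> 2x, and F(b) - F(a)
   would not be determined by f. *)
Definition M_antiderivative (F f : C -> C) : Prop :=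
  continuous F (RtoC 0) /\ forall x : C, is_M_derive F x (f x).

(* [is_M_integral f a b I]: f has an M-antiderivative, and F(b) - F(a) = I for
   every M-antiderivative F of f. *)
Definition is_M_integral (f : C -> C) (a b : R) (I : C) : Prop :=
  (exists F : C -> C, M_antiderivative F f) /\
  (forall F : C -> C, M_antiderivative F f ->
     (F (RtoC b) - F (RtoC a))%C = I).

(* Main.v *)
Require Import Defs.
From Stdlib Require Import Reals Lra Lia.
From Coquelicot Require Import Coquelicot.

(** Both families of values are weighted series sum_m w_m P_{n,M}(x;m), and only
    the decay of the weights w matters; let L_n(x) be such a series.  The
    translation polynomials form an Appell-type sequence in x: P_{n,M}(x;m) is
    M_n! times the coefficient of t^n in e_M^{xt} c_m(t), where
    c_m(t) = (e_M^t)^m does not depend on x.  Summing against the weights keeps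
    this shape, so L_n(x) / M_n! is the coefficient of t^n in e_M^{xt} s(t) with
    s_j = sum_m w_m [t^j] c_m ([lerch_sum_appell]).

    Two facts about the integral finish the proof.  First, e_M^{xt} is an
    eigenfunction of the M-derivative, (e_M^{2xt} - e_M^{xt}) / x = t e_M^{xt},
    and comparing coefficients of t^{n+1} gives
    D_x L_{n+1} = M_{n+1} L_n ([M_quot_lerch_sum]); hence L_{n+1} / M_{n+1} is an
    M-antiderivative of L_n, its behaviour at 0 being controlled because L_n and
    L_{n+1} are polynomials in x.  Second, two M-antiderivatives of the same
    function differ by a function invariant under x |-> 2x and continuous at 0,
    which is constant ([doubling_invariant_constant]).

    The analytic input is that the series for s_j converges absolutely, which
    allows the exchange of the sum over m with the finite sum over powers of x.
    Since M_k! >= 1, the coefficients of c_m are dominated by those of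
    (1 - t)^{-m}, so |[t^j] c_m| <= (m+1)^j.  The binomial weights are at most
    (m+1)^{r-1}, so everything reduces to the convergence of
    sum_m (m+1)^p |lambda|^m. *)

(** * Absolutely convergent complex series *)

Definition abs_summable (u : nat -> C) : Prop :=
  ex_series (fun m => Cmod (u m)).

Lemma abs_summable_le (u : nat -> C) (v : nat -> R) :
  (forall m, Cmod (u m) <= v m) -> ex_series v -> abs_summable u.
Proof.
intros H Hv. apply (ex_series_le (V := R_CompleteNormedModule) _ v); [|exact Hv].
intros m. change (Rabs (Cmod (u m)) <= v m).
rewrite Rabs_pos_eq; [apply H | apply Cmod_ge_0].
Qed.

Lemma abs_summable_Re (u : nat -> C) :
  abs_summable u -> ex_series (fun m => Re (u m)).
Proof.
intros H.
apply (ex_series_le (V := R_CompleteNormedModule) _ (fun m => Cmod (u m)));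
  [|exact H].
intros m. apply re_le_Cmod.
Qed.

Lemma abs_summable_Im (u : nat -> C) :
  abs_summable u -> ex_series (fun m => Im (u m)).
Proof.
intros H.
apply (ex_series_le (V := R_CompleteNormedModule) _ (fun m => Cmod (u m)));
  [|exact H].
intros m. eapply Rle_trans; [|apply Rmax_Cmod]. apply Rmax_r.
Qed.

Lemma abs_summable_plus (u v : nat -> C) :
  abs_summable u -> abs_summable v -> abs_summable (fun m => u m + v m)%C.
Proof.
intros Hu Hv. apply (abs_summable_le _ (fun m => Cmod (u m) + Cmod (v m))).
- intros m. apply Cmod_triangle.
- exact (ex_series_plus _ _ Hu Hv).
Qed.

Lemma abs_summable_scal (c : C) (u : nat -> C) :
  abs_summable u -> abs_summable (fun m => c * u m)%C.
Proof.
intros Hu. apply (abs_summable_le _ (fun m => Cmod c * Cmod (u m))).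
- intros m. rewrite Cmod_mult. apply Rle_refl.
- exact (ex_series_scal_l (Cmod c) _ Hu).
Qed.

Lemma CSeries_ext (u v : nat -> C) :
  (forall m, u m = v m) -> CSeries u = CSeries v.
Proof.
intros H. unfold CSeries. f_equal; apply Series_ext; intros m; now rewrite H.
Qed.

Lemma CSeries_plus (u v : nat -> C) :
  abs_summable u -> abs_summable v ->
  CSeries (fun m => u m + v m)%C = (CSeries u + CSeries v)%C.
Proof.
intros Hu Hv. unfold CSeries, Cplus; cbn [fst snd]. f_equal.
- apply Series_plus; now apply abs_summable_Re.
- apply Series_plus; now apply abs_summable_Im.
Qed.

Lemma CSeries_scal (c : C) (u : nat -> C) :
  abs_summable u -> CSeries (fun m => c * u m)%C = (c * CSeries u)%C.
Proof.
intros Hu. pose proof (abs_summable_Re _ Hu) as Hr.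
pose proof (abs_summable_Im _ Hu) as Hi.
unfold CSeries, Cmult; cbn [fst snd]; f_equal.
- rewrite <- !Series_scal_l. rewrite <- Series_minus; [reflexivity| |];
  now apply (ex_series_scal_l (V := R_NormedModule)).
- rewrite <- !Series_scal_l. rewrite <- Series_plus; [reflexivity| |];
  now apply (ex_series_scal_l (V := R_NormedModule)).
Qed.

Lemma abs_summable_sum_n (u : nat -> nat -> C) (n : nat) :
  (forall k, abs_summable (u k)) ->
  abs_summable (fun m => sum_n (fun k => u k m) n).
Proof.
intros Hu. induction n as [|n IH].
- apply (ex_series_ext (fun m => Cmod (u O m))); [|apply Hu].
  intros m. now rewrite sum_O.
- apply (ex_series_ext
    (fun m => Cmod (sum_n (fun k => u k m) n + u (S n) m)%C)).
  + intros m. now rewrite sum_Sn.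
  + now apply abs_summable_plus.
Qed.

Lemma CSeries_sum_n (u : nat -> nat -> C) (n : nat) :
  (forall k, abs_summable (u k)) ->
  CSeries (fun m => sum_n (fun k => u k m) n) = sum_n (fun k => CSeries (u k)) n.
Proof.
intros Hu. induction n as [|n IH].
- rewrite sum_O. apply CSeries_ext. intros m. now rewrite sum_O.
- rewrite sum_Sn, <- IH.
  rewrite (CSeries_ext _ (fun m => sum_n (fun k => u k m) n + u (S n) m)%C).
  + apply CSeries_plus; [now apply abs_summable_sum_n | apply Hu].
  + intros m. now rewrite sum_Sn.
Qed.

(** * Growth of the coefficients of powers of the M-exponential *)

Lemma mersenne_S_ge_1 (n : nat) : 1 <= mersenne (S n).
Proof.
unfold mersenne. pose proof (pow_R1_Rle 2 n ltac:(lra)). simpl. lra.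
Qed.

Lemma mersenne_fact_ge_1 (n : nat) : 1 <= mersenne_fact n.
Proof.
induction n as [|n IH]; simpl; [lra|].
pose proof (mersenne_S_ge_1 n). nra.
Qed.

Lemma mersenne_fact_neq_0 (n : nat) : RtoC (mersenne_fact n) <> 0.
Proof.
intros H. apply RtoC_inj in H. pose proof (mersenne_fact_ge_1 n). lra.
Qed.

Lemma mersenne_S_neq_0 (n : nat) : RtoC (mersenne (S n)) <> 0.
Proof.
intros H. apply RtoC_inj in H. pose proof (mersenne_S_ge_1 n). lra.
Qed.

(** The left side is the binomial expansion of the right side with every
    coefficient lowered to 1; it gives the step from m to m+1 in
    [Cmod_fps_pow_M_exp_le]. *)
Lemma sum_n_pow_le (y : R) (j : nat) :
  0 <= y -> sum_n (fun k => y ^ (j - k)) j <= (y + 1) ^ j.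
Proof.
intros Hy. induction j as [|j IH].
- rewrite sum_O. simpl. lra.
- unfold sum_n in *. rewrite sum_Sn_m by lia.
  rewrite <- sum_n_m_S.
  change (y ^ (S j - 0) + sum_n_m (fun k => y ^ (j - k)) 0 j
          <= (y + 1) ^ (S j)).
  rewrite Nat.sub_0_r. simpl.
  pose proof (pow_incr y (y + 1) j ltac:(lra)). nra.
Qed.

Lemma Cmod_M_exp_1_le (k : nat) : Cmod (M_exp 1 k) <= 1.
Proof.
unfold M_exp. rewrite Cmod_div by apply mersenne_fact_neq_0.
rewrite Cpow_1_l, Cmod_1, Cmod_R.
pose proof (mersenne_fact_ge_1 k). rewrite Rabs_pos_eq by lra.
apply Rle_div_l; lra.
Qed.

(** For fixed j the coefficient grows only polynomially in m, because one more
    factor e_M^t, whose coefficients lie in [0,1], replaces it by at most a sum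
    of the lower-index bounds (m+1)^{j-k}. *)
Lemma Cmod_fps_pow_M_exp_le (m j : nat) :
  Cmod (fps_pow (M_exp 1) m j) <= INR (S m) ^ j.
Proof.
revert j. induction m as [|m IH]; intros j.
- simpl INR. rewrite pow1. destruct j; simpl.
  + rewrite Cmod_1. lra.
  + rewrite Cmod_0. lra.
- rewrite (S_INR (S m)).
  eapply Rle_trans; [|apply sum_n_pow_le, pos_INR].
  simpl fps_pow. unfold fps_mul.
  eapply Rle_trans;
    [apply (norm_sum_n_m (K := C_AbsRing) (V := C_NormedModule))|].
  apply sum_n_m_le. intros k.
  change (Cmod (M_exp 1 k * fps_pow (M_exp 1) m (j - k)%nat)
            <= INR (S m) ^ (j - k)).
  rewrite Cmod_mult, <- (Rmult_1_l (INR (S m) ^ (j - k))).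
  apply Rmult_le_compat; auto using Cmod_ge_0, Cmod_M_exp_1_le.
Qed.

(** * Weighted sums of the translation polynomials *)

Definition rapidly_summable (w : nat -> C) : Prop :=
  forall p : nat, ex_series (fun m => INR (S m) ^ p * Cmod (w m)).

Definition lerch_sum (w : nat -> C) (n : nat) (x : C) : C :=
  CSeries (fun m => w m * M_translation n x m)%C.

(** The Appell constants: the power series s(t) = sum_m w_m (e_M^t)^m. *)
Definition lerch_const (w : nat -> C) : fps :=
  fun j => CSeries (fun m => w m * fps_pow (M_exp 1) m j)%C.

Lemma abs_summable_lerch_const (w : nat -> C) (j : nat) :
  rapidly_summable w ->
  abs_summable (fun m => w m * fps_pow (M_exp 1) m j)%C.
Proof.
intros Hw. apply (abs_summable_le _ (fun m => INR (S m) ^ j * Cmod (w m))).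
- intros m. rewrite Cmod_mult, Rmult_comm.
  apply Rmult_le_compat_r; [apply Cmod_ge_0 | apply Cmod_fps_pow_M_exp_le].
- apply Hw.
Qed.

Lemma sum_n_Cmult_l (c : C) (u : nat -> C) (n : nat) :
  sum_n (fun k => c * u k)%C n = (c * sum_n u n)%C.
Proof. exact (sum_n_mult_l (K := C_Ring) c u n). Qed.

(** Each translation polynomial is a finite sum over powers of x, so absolute
    convergence of the coefficient series lets the sum over m pass inside;
    this exhibits the weighted sum as a polynomial in x. *)
Lemma lerch_sum_appell (w : nat -> C) (n : nat) (x : C) :
  rapidly_summable w ->
  lerch_sum w n x
  = (mersenne_fact n * fps_mul (M_exp x) (lerch_const w) n)%C.
Proof.
intros Hw. unfold lerch_sum, M_translation, fps_mul.
pose proof (fun j => abs_summable_lerch_const w j Hw) as Hs.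
assert (Hk : forall k, abs_summable (fun m =>
          M_exp x k * (w m * fps_pow (M_exp 1) m (n - k)%nat))%C).
{ intros k. apply abs_summable_scal, Hs. }
rewrite (CSeries_ext _ (fun m => mersenne_fact n * sum_n (fun k =>
          M_exp x k * (w m * fps_pow (M_exp 1) m (n - k)%nat))%C n)%C).
- rewrite CSeries_scal by now apply abs_summable_sum_n.
  rewrite CSeries_sum_n by exact Hk.
  f_equal. apply sum_n_ext. intros k. unfold lerch_const.
  now rewrite CSeries_scal by apply Hs.
- intros m. rewrite Cmult_assoc, (Cmult_comm (w m)), <- Cmult_assoc.
  rewrite <- sum_n_Cmult_l. f_equal. apply sum_n_ext. intros k.
  now rewrite !Cmult_assoc, (Cmult_comm (w m)).
Qed.

(** The coefficient form of (e_M^{2xt} - e_M^{xt}) = x t e_M^{xt}: it holds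
    because 2^{k+1} - 1 is exactly the factor by which M_{k+1}! exceeds M_k!. *)
Lemma M_exp_double_sub (x : C) (k : nat) :
  (M_exp (2 * x) (S k) - M_exp x (S k) = x * M_exp x k)%C.
Proof.
unfold M_exp. rewrite Cpow_mult_l. simpl mersenne_fact.
rewrite RtoC_mult.
pose proof (mersenne_fact_neq_0 k). pose proof (mersenne_S_neq_0 k).
assert (E : RtoC (mersenne (S k)) = (2 ^ S k - 1)%C).
{ unfold mersenne. now rewrite RtoC_minus, RtoC_pow. }
replace (2 ^ S k)%C with (mersenne (S k) + 1)%C by (rewrite E; ring).
rewrite (Cpow_S x). field. now split.
Qed.

Lemma sum_n_shift_sub (u v d : nat -> C) (x : C) (n : nat) :
  u O = v O -> (forall k, (u (S k) - v (S k) = x * d k)%C) ->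
  (sum_n u (S n) - sum_n v (S n) = x * sum_n d n)%C.
Proof.
intros H0 HS. induction n as [|n IH].
- rewrite !sum_Sn, !sum_O, H0. change plus with Cplus.
  rewrite <- (HS O). ring.
- rewrite (sum_Sn u), (sum_Sn v), (sum_Sn d). change plus with Cplus.
  rewrite Cmult_plus_distr_l, <- IH, <- HS. ring.
Qed.

Lemma fps_mul_M_exp_double_sub (s : fps) (n : nat) (x : C) :
  (fps_mul (M_exp (2 * x)) s (S n) - fps_mul (M_exp x) s (S n)
   = x * fps_mul (M_exp x) s n)%C.
Proof.
unfold fps_mul. apply sum_n_shift_sub.
- reflexivity.
- intros k. simpl Nat.sub. rewrite Cmult_assoc, <- M_exp_double_sub. ring.
Qed.

(** The product of limits is available for the topology of the modulus, whereas
    continuity is here meant for the product topology on pairs of reals;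
    [locally_C] says that the two have the same neighbourhoods. *)
Lemma continuous_Cmult (f g : C -> C) (x : C) :
  continuous f x -> continuous g x -> continuous (fun z => f z * g z)%C x.
Proof.
intros Hf Hg. unfold continuous.
assert (Hfg : filterlim (fun z => f z * g z)%C (locally x)
  (locally (T := AbsRing_UniformSpace C_AbsRing) (f x * g x)%C)).
{ apply (filterlim_comp_2 (H := locally (T := AbsRing_UniformSpace C_AbsRing) (g x))
   (G := locally (T := AbsRing_UniformSpace C_AbsRing) (f x)) f g Cmult).
  - intros P HP. apply Hf. now apply locally_C.
  - intros P HP. apply Hg. now apply locally_C.
  - apply (filterlim_mult (K := C_AbsRing)). }
intros P HP. apply Hfg. now apply locally_C.
Qed.

Lemma continuous_Cpow (k : nat) (x : C) : continuous (fun z => z ^ k)%C x.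
Proof.
induction k as [|k IH]; simpl.
- apply continuous_const.
- apply continuous_Cmult; [apply continuous_id | exact IH].
Qed.

Lemma continuous_fps_mul_M_exp (s : fps) (n : nat) (x : C) :
  continuous (fun z => fps_mul (M_exp z) s n) x.
Proof.
unfold fps_mul.
(* The induction runs over the upper limit only; n stays fixed in the indices. *)
generalize n at 2 as N. intros N.
assert (Hk : forall k, continuous (fun z => M_exp z k * s (n - k)%nat)%C x).
{ intros k. apply continuous_Cmult; [|apply continuous_const].
  apply continuous_Cmult; [apply continuous_Cpow | apply continuous_const]. }
induction N as [|N IH].
- apply (continuous_ext (fun z => M_exp z O * s (n - 0)%nat)%C); [|apply Hk].
  intros z. now rewrite sum_O.
- apply (continuous_ext (fun z => plus
    (sum_n (fun k => M_exp z k * s (n - k)%nat)%C N : C_R_NormedModule)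
    (M_exp z (S N) * s (n - S N)%nat)%C)).
  + intros z. now rewrite sum_Sn.
  + apply (continuous_plus (V := C_R_NormedModule)); [exact IH | apply Hk].
Qed.

Lemma continuous_lerch_sum (w : nat -> C) (n : nat) (x : C) :
  rapidly_summable w -> continuous (fun z => lerch_sum w n z) x.
Proof.
intros Hw.
apply (continuous_ext
  (fun z => mersenne_fact n * fps_mul (M_exp z) (lerch_const w) n)%C).
- intros z. now rewrite lerch_sum_appell.
- apply continuous_Cmult;
    [apply continuous_const | apply continuous_fps_mul_M_exp].
Qed.

(** With [lerch_sum_appell] this is the comparison of coefficients of t^{n+1} in
    the eigenfunction property of e_M^{xt}, whose factor t lowers the index. *)
Lemma M_quot_lerch_sum (w : nat -> C) (n : nat) (x : C) :
  rapidly_summable w -> x <> 0 ->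
  M_quot (fun z => lerch_sum w (S n) z / mersenne (S n))%C x
  = lerch_sum w n x.
Proof.
intros Hw Hx. unfold M_quot. rewrite !lerch_sum_appell by exact Hw.
simpl mersenne_fact. rewrite RtoC_mult.
pose proof (fps_mul_M_exp_double_sub (lerch_const w) n x) as E.
pose proof (mersenne_S_neq_0 n) as Hn.
transitivity (mersenne_fact n * (fps_mul (M_exp (2 * x)) (lerch_const w) (S n)
   - fps_mul (M_exp x) (lerch_const w) (S n)) / x)%C.
- field. now split.
- rewrite E. field. exact Hx.
Qed.

(** * M-antiderivatives: construction and uniqueness *)

(** The limit demanded at 0 is automatic when f is continuous there, since the
    difference quotient coincides with f off 0. *)
Lemma M_antiderivative_of_quot (F f : C -> C) :
  continuous F (RtoC 0) -> continuous f (RtoC 0) ->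
  (forall x, x <> RtoC 0 -> M_quot F x = f x) ->
  M_antiderivative F f.
Proof.
intros HF Hf Hq. split; [exact HF|]. intros x. split; [apply Hq|].
intros ->. apply (filterlim_ext_loc f).
- exists (mkposreal 1 Rlt_0_1). intros y _ Hy. symmetry. now apply Hq.
- intros P HP. specialize (Hf P HP). unfold filtermap in *.
  unfold locally', within. revert Hf. apply filter_imp. now intros.
Qed.

Lemma filterlim_Cmult_half_pow (x : C) :
  filterlim (fun k : nat => x * RtoC ((/ 2) ^ k))%C eventually
    (locally (RtoC 0)).
Proof.
assert (H : forall c : R, is_lim_seq (fun k => c * (/ 2) ^ k) 0).
{ intros c. rewrite <- (Rmult_0_r c).
  apply (is_lim_seq_scal_l _ c 0).
  apply is_lim_seq_geom. rewrite Rabs_pos_eq; lra. }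
apply filterlim_locally. intros eps.
pose proof (proj1 (filterlim_locally _ _) (H (fst x)) eps) as H1.
pose proof (proj1 (filterlim_locally _ _) (H (snd x)) eps) as H2.
generalize (filter_and _ _ H1 H2). apply filter_imp.
intros k [K1 K2]. split.
- simpl. now replace (fst x * (/ 2) ^ k - snd x * 0) with (fst x * (/ 2) ^ k) by ring.
- simpl. now replace (fst x * 0 + snd x * (/ 2) ^ k) with (snd x * (/ 2) ^ k) by ring.
Qed.

(** The value at x is also the value at x / 2^k for every k, and these points
    tend to 0. *)
Lemma doubling_invariant_constant (G : C -> C) (x : C) :
  continuous G (RtoC 0) -> (forall z, G (2 * z)%C = G z) ->
  G x = G (RtoC 0).
Proof.
intros Hc Hd.
assert (Hk : forall k : nat, G (x * RtoC ((/ 2) ^ k))%C = G x).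
{ intros k. induction k as [|k IH].
  - simpl. now rewrite Cmult_1_r.
  - rewrite <- IH, <- Hd. f_equal. simpl pow.
    rewrite RtoC_mult, RtoC_inv by lra.
    field. }
apply (filterlim_locally_unique (V := C_R_NormedModule) (F := eventually)
  (fun k : nat => G (x * RtoC ((/ 2) ^ k))%C)).
- apply (filterlim_ext (fun _ => G x)); [now intros|].
  apply filterlim_const.
- exact (filterlim_comp _ _ _ _ _ _ _ _ (filterlim_Cmult_half_pow x) Hc).
Qed.

(** Clearing the denominator makes the identity hold at 0 as well, so the
    difference of two antiderivatives is invariant under doubling everywhere. *)
Lemma M_antiderivative_double (F f : C -> C) (z : C) :
  M_antiderivative F f -> (F (2 * z) - F z = z * f z)%C.
Proof.
intros [_ HF]. destruct (Ceq_dec z 0) as [->|Hz].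
- rewrite !Cmult_0_r, Cmult_0_l. ring.
- destruct (HF z) as [Hq _]. rewrite <- (Hq Hz). unfold M_quot. now field.
Qed.

Lemma M_antiderivative_unique (F G f : C -> C) (a b : C) :
  M_antiderivative F f -> M_antiderivative G f ->
  (F b - F a = G b - G a)%C.
Proof.
intros HF HG.
assert (H : forall x, (F x - G x = F (RtoC 0) - G (RtoC 0))%C).
{ intros x. apply (doubling_invariant_constant (fun z => F z - G z)%C).
  - apply (continuous_minus (V := C_R_NormedModule)); [apply HF | apply HG].
  - intros z. pose proof (M_antiderivative_double F f z HF) as E1.
    pose proof (M_antiderivative_double G f z HG) as E2.
    (* Both increments equal z f(z), so they cancel in F - G. *)
    rewrite <- E2 in E1.
    replace (F (2 * z)%C) with (F z + (F (2 * z) - F z))%C by ring.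
    rewrite E1. ring. }
replace (F b) with (G b + (F b - G b))%C by ring.
replace (F a) with (G a + (F a - G a))%C by ring.
rewrite (H b), (H a). ring.
Qed.

Lemma is_M_integral_intro (F f : C -> C) (a b : R) :
  M_antiderivative F f -> is_M_integral f a b (F (RtoC b) - F (RtoC a))%C.
Proof.
intros HF. split; [now exists F|].
intros G HG. exact (M_antiderivative_unique G F f a b HG HF).
Qed.

Lemma is_M_integral_lerch_sum (w : nat -> C) (n : nat) (a b : R) :
  rapidly_summable w ->
  is_M_integral (fun x => lerch_sum w n x) a b
    ((lerch_sum w (n + 1) b - lerch_sum w (n + 1) a) / mersenne (n + 1))%C.
Proof.
intros Hw. rewrite Nat.add_1_r.
replace ((lerch_sum w (S n) b - lerch_sum w (S n) a) / mersenne (S n))%C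
  with (lerch_sum w (S n) b / mersenne (S n)
        - lerch_sum w (S n) a / mersenne (S n))%C
  by (field; apply mersenne_S_neq_0).
apply (is_M_integral_intro (fun z => lerch_sum w (S n) z / mersenne (S n))%C).
apply M_antiderivative_of_quot.
- apply continuous_Cmult; [now apply continuous_lerch_sum|].
  apply continuous_const.
- now apply continuous_lerch_sum.
- intros x Hx. now apply M_quot_lerch_sum.
Qed.

(** * Decay of the binomial weights *)

(** The power series with coefficients (m+1)^{p+1} is the derivative of X times
    the one with coefficients (m+1)^p; neither multiplication by X nor
    differentiation changes the radius of convergence, so it stays that of the
    geometric series. *)
Lemma ex_series_pow_geom (p : nat) (q : R) :
  Rabs q < 1 -> ex_series (fun m => INR (S m) ^ p * Rabs q ^ m).
Proof.
intros Hq.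
assert (HR : CV_radius (fun m => INR (S m) ^ p) = Finite 1).
{ induction p as [|p IH].
  - rewrite (CV_radius_finite_DAlembert _ 1).
    + now rewrite Rinv_1.
    + intros m. simpl. lra.
    + lra.
    + apply (is_lim_seq_ext (fun _ => 1)); [|apply is_lim_seq_const].
      intros m. simpl pow. rewrite Rdiv_1_r. now rewrite Rabs_R1.
  - rewrite <- IH, <- (CV_radius_incr_1 (fun m => INR (S m) ^ p)),
      <- (CV_radius_derive (PS_incr_1 _)).
    apply CV_radius_ext. intros m. reflexivity. }
apply (ex_series_ext (fun m => Rabs (INR (S m) ^ p * q ^ m))).
- intros m. rewrite Rabs_mult, RPow_abs, Rabs_pos_eq; [reflexivity|].
  apply pow_le, pos_INR.
- apply CV_disk_inside. now rewrite HR.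
Qed.

(** Passing from s to s+1 multiplies the binomial coefficient by
    (m+s+1)/(s+1), which is at most m+1. *)
Lemma binomial_repetition_le (m s : nat) :
  0 <= Binomial.C (m + s) m <= INR (S m) ^ s.
Proof.
induction s as [|s [IH0 IH]].
- unfold Binomial.C. rewrite Nat.add_0_r, Nat.sub_diag.
  simpl. rewrite Rmult_1_r, Rdiv_diag by apply INR_fact_neq_0. lra.
- assert (E : Binomial.C (m + S s) m
    = Binomial.C (m + s) m * (INR (m + S s) / INR (S s))).
  { unfold Binomial.C.
    replace (m + S s - m)%nat with (S s) by lia.
    replace (m + s - m)%nat with s by lia.
    rewrite Nat.add_succ_r, (fact_simpl (m + s)), (fact_simpl s), !mult_INR.
    pose proof (INR_fact_neq_0 m). pose proof (INR_fact_neq_0 s).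
    pose proof (not_0_INR (S s) ltac:(lia)).
    field. now repeat split. }
  assert (0 < INR (S s)) by (apply lt_0_INR; lia).
  assert (0 <= INR (m + S s) / INR (S s) <= INR (S m)).
  { split; [apply Rdiv_le_0_compat; [apply pos_INR | assumption]|].
    apply Rle_div_l; [assumption|]. rewrite <- mult_INR. apply le_INR. nia. }
  rewrite E. change (INR (S m) ^ S s) with (INR (S m) * INR (S m) ^ s).
  rewrite (Rmult_comm (INR (S m))). split.
  + now apply Rmult_le_pos.
  + now apply Rmult_le_compat.
Qed.

Lemma rapidly_summable_of_Cmod (r : nat) (q : R) (w : nat -> C) :
  (1 <= r)%nat -> 0 <= q < 1 ->
  (forall m, Cmod (w m) = Binomial.C (m + r - 1) m * q ^ m) ->
  rapidly_summable w.
Proof.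
intros Hr Hq Hw p.
apply (ex_series_le (V := R_CompleteNormedModule) _
  (fun m => INR (S m) ^ (p + (r - 1)) * Rabs q ^ m)).
- intros m. rewrite (Rabs_pos_eq q) by lra.
  change (Rabs (INR (S m) ^ p * Cmod (w m))
     <= INR (S m) ^ (p + (r - 1)) * q ^ m).
  assert (Hp : 0 <= INR (S m) ^ p) by apply pow_le, pos_INR.
  rewrite Rabs_pos_eq by (apply Rmult_le_pos; [exact Hp | apply Cmod_ge_0]).
  rewrite pow_add, Rmult_assoc. apply Rmult_le_compat_l; [exact Hp|].
  rewrite Hw. apply Rmult_le_compat_r; [apply pow_le; lra|].
  replace (m + r - 1)%nat with (m + (r - 1))%nat by lia.
  apply binomial_repetition_le.
- apply ex_series_pow_geom. rewrite Rabs_pos_eq; lra.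
Qed.

Lemma Cmod_binomial_weight (r m : nat) (z : C) :
  (1 <= r)%nat ->
  Cmod (Binomial.C (m + r - 1) m * z ^ m)%C
  = Binomial.C (m + r - 1) m * Cmod z ^ m.
Proof.
intros Hr. rewrite Cmod_mult, Cmod_R, Cmod_pow, Rabs_pos_eq; [reflexivity|].
replace (m + r - 1)%nat with (m + (r - 1))%nat by lia.
apply binomial_repetition_le.
Qed.

Theorem theorem7p2 (r n : nat) (a b : R) (lam : C)
    (hr : (1 <= r)%nat) (hlam : (Cmod lam < 1)%R) :
  is_M_integral (fun x : C => Phi_B r lam n x) a b
    ((Phi_B r lam (n + 1) (RtoC b) - Phi_B r lam (n + 1) (RtoC a))
       / RtoC (mersenne (n + 1)))%C
  /\
  is_M_integral (fun x : C => Phi_E r lam n x) a b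
    ((Phi_E r lam (n + 1) (RtoC b) - Phi_E r lam (n + 1) (RtoC a))
       / RtoC (mersenne (n + 1)))%C.
Proof.
assert (hq : 0 <= Cmod lam < 1) by (split; [apply Cmod_ge_0 | exact hlam]).
split.
- apply (is_M_integral_lerch_sum
    (fun m => Binomial.C (m + r - 1) m * lam ^ m)%C).
  apply (rapidly_summable_of_Cmod r (Cmod lam)); [exact hr | exact hq |].
  intros m. now apply Cmod_binomial_weight.
- apply (is_M_integral_lerch_sum
    (fun m => (-1) ^ m * Binomial.C (m + r - 1) m * lam ^ m)%C).
  apply (rapidly_summable_of_Cmod r (Cmod lam)); [exact hr | exact hq |].
  intros m. rewrite <- Cmult_assoc, Cmod_mult, Cmod_binomial_weight by exact hr.
  rewrite Cmod_pow, Cmod_R, Rabs_m1, pow1. ring.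
Qed.
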